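(* Let $p$ be a prime. For every $a,b,c,d,k\in \mathbb{N}_0$ with $k\le a+b+c+d$ we have $$N(p^a,p^b,p^c,p^d;p^k)= \sum \varphi(p^{x_3})\, \varphi(p^{y_3})\, \varphi(p^{z_3})\, \varphi(p^{t_3})\, F(p^u,p^v),$$ where the sum is over all $$(x_1,x_2,x_3,x_4,x_5,y_1,y_2,y_3,y_4,y_5,z_1,z_2,z_3,z_4,z_5,t_1,t_2,t_3,t_4,t_5)\in\mathbb{N}_0^{20}$$ satisfying the following $11$ conditions: (i) $x_1+x_2+x_3=a$, (ii) $x_3+x_4+x_5=b$, (iii) $y_1+y_2+y_3=\min(x_1,x_4)$, (iv) $y_3+y_4+y_5=x_3+\max(x_1,x_4)$, (v) $z_1+z_2+z_3=c$, (vi) $z_3+z_4+z_5=d$, (vii) $t_1+t_2+t_3=\min(z_1,z_4)$, (viii) $t_3+t_4+t_5=z_3+\max(z_1,z_4)$, (ix) $\min(y_2,y_5)=\min(t_2,t_5)=:u$, (x) $y_3+\max(y_2,y_5)= t_3+ \max(t_2,t_5)=:v$, (xi) $x_1+x_3+x_4+t_1+t_3+t_4=k$.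
   Context: $\mathbb{N}_0=\{0,1,2,\ldots\}$ and $\mathbb{Z}_n$ is the additive group of residue classes modulo $n$. $N(m,n,r,s;q)$ denotes the number of subgroups of order $q$ of the group $\mathbb{Z}_m\times\mathbb{Z}_n\times\mathbb{Z}_r\times\mathbb{Z}_s$. $\varphi$ is Euler's totient function. $F(m,n)$ denotes the number of automorphisms of the group $\mathbb{Z}_m\times\mathbb{Z}_n$. *)

(* Defs.v *)
From mathcomp Require Import classical_sets cardinality fsbigop.
From mathcomp Require Import all_boot all_order all_algebra all_fingroup.
From mathcomp Require Import zify.

Set Implicit Arguments.
Unset Strict Implicit.
Unset Printing Implicit Defensive.

(* [Zp n] is the subgroup of ['Z_n] that is cyclic of order [n] for every      *)
(* [n > 0]; for [n = 1] the type ['Z_1] itself has two elements.               *)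
Definition Zp2 (m n : nat) : {group 'Z_m * 'Z_n} :=
  setX_group (Zp_group m) (Zp_group n).

Definition Zp4 (m n r s : nat) : {group ('Z_m * 'Z_n) * ('Z_r * 'Z_s)} :=
  setX_group (Zp2 m n) (Zp2 r s).

Definition num_subgroups (m n r s q : nat) : nat :=
  #|[set H in subgroups (Zp4 m n r s) | #|H| == q]|.

(* An element of [Aut G] is a permutation of the ambient type that fixes       *)
(* every point outside [G], so it is determined by its restriction to [G].     *)
Definition num_aut (m n : nat) : nat := #|Aut (Zp2 m n)|.

Definition quint : Type := (nat * nat * nat * nat * nat)%type.

Definition index_set (a b c d k : nat) : set (quint * quint * quint * quint) :=
  fun w =>
  let: ((x1, x2, x3, x4, x5), (y1, y2, y3, y4, y5),
        (z1, z2, z3, z4, z5), (t1, t2, t3, t4, t5)) := w in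
  [&& x1 + x2 + x3 == a,
      x3 + x4 + x5 == b,
      y1 + y2 + y3 == minn x1 x4,
      y3 + y4 + y5 == x3 + maxn x1 x4,
      z1 + z2 + z3 == c,
      z3 + z4 + z5 == d,
      t1 + t2 + t3 == minn z1 z4,
      t3 + t4 + t5 == z3 + maxn z1 z4,
      minn y2 y5 == minn t2 t5,
      y3 + maxn y2 y5 == t3 + maxn t2 t5 &
      x1 + x3 + x4 + t1 + t3 + t4 == k].

Definition summand (p : nat) (w : quint * quint * quint * quint) : nat :=
  let: ((x1, x2, x3, x4, x5), (y1, y2, y3, y4, y5),
        (z1, z2, z3, z4, z5), (t1, t2, t3, t4, t5)) := w in
  let u := minn y2 y5 in
  let v := y3 + maxn y2 y5 in
  totient (p ^ x3) * totient (p ^ y3) * totient (p ^ z3) * totient (p ^ t3)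
    * num_aut (p ^ u) (p ^ v).

(* [\big[op/idx]_(i \in A) f i] is [idx] when [f] has infinite support on [A]; *)
(* the next lemma shows that this convention plays no role for [index_set].    *)
Lemma finite_index_set (a b c d k : nat) :
  finite_set (index_set a b c d k).
Proof.
pose I := `I_(a + b + c + d).+1.
pose Q := (I `*` I `*` I `*` I `*` I)%classic.
apply: (@sub_finite_set _ _ (Q `*` Q `*` Q `*` Q)%classic); last first.
  by rewrite /Q; do !apply: finite_setX; exact: finite_II.
move=> [[[[[[[x1 x2] x3] x4] x5] [[[[y1 y2] y3] y4] y5]]
  [[[[z1 z2] z3] z4] z5]] [[[[t1 t2] t3] t4] t5]].
case/and5P=> /eqP h1 /eqP h2 /eqP h3 /eqP h4 /and5P[/eqP h5 /eqP h6 /eqP h7].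
move=> /eqP h8 _.
by rewrite /Q /I /=; lia.
Qed.

(* Main.v *)
Require Import Defs.
From mathcomp Require Import classical_sets cardinality fsbigop.
From mathcomp Require Import all_boot all_order all_algebra all_fingroup.
From mathcomp Require Import all_solvable zify.

(* By Goursat's lemma a subgroup [H] of a product [G * K] amounts to sections  *)
(* [A / B] of [G] and [C / D] of [K] together with an isomorphism between      *)
(* them, and [#|H| = #|A| * #|D|]. For [G] and [K] of rank two this leaves     *)
(* the chains [B <= A <= G] to be counted. Applied to a product of two cyclic  *)
(* [p]-groups, Goursat's lemma parametrizes [A] by a quintuple [x] with        *)
(* multiplicity [totient (p ^ x3)]. Since an abelian group of rank at most two *)
(* is determined by its order and its exponent, [x] also gives the type of [A] *)
(* and of its quotient: the exponent of a subdirect product is the lcm of the  *)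
(* exponents of its projections, and dually for the quotient. So [A] can be    *)
(* replaced by a product of two cyclic groups, whose subgroups [B] are counted *)
(* in the same way by a quintuple [y].                                         *)

Set Implicit Arguments.
Unset Strict Implicit.
Unset Printing Implicit Defensive.

Import GroupScope.

(** * Goursat's lemma *)

(** Write the group as [G * K] with [G] and [K] products of two cyclic [p]-groups. Goursat's lemma
    gives the number of subgroups of order [p ^ k] as the sum of [#|Aut (A / B)|] over all chains
    [B <= A <= G] and [D <= C <= K] with [A / B] isomorphic to [C / D] and [#|A| * #|D| = p ^ k]
    ([card_subgroups_setX]). The quintuples [x], [y], [z], [t] record [A], [B], [C], [D]. By
    Goursat's lemma in the cyclic case, together with the uniqueness of the subgroups of given order
    in a cyclic group, a quintuple [x] belongs to exactly [totient (p ^ x3)] subgroups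
    ([card_quint_of]). The weights multiply along a chain, because [A] is isomorphic to a product of
    cyclic groups of orders [p ^ qmin x] and [p ^ qmax x], in which [B] is described by [y]
    ([sum_chains]). Conditions (i)-(viii) say which quintuples occur, (ix) and (x) that [A / B] and
    [C / D] have the same type ([isog_quotient_quint]), and (xi) that [#|A| * #|D| = p ^ k]. The
    automorphisms of the common quotient contribute the last factor. *)

Section Goursat.

Variables gT1 gT2 : finGroupType.
Implicit Types (H : {group gT1 * gT2}) (A B : {group gT1}) (C D : {group gT2}).

Definition projg1 H : {group gT1} := [group of [morphism of fst] @* H].
Definition ker1 H : {group gT1} := [group of @pairg1 gT1 gT2 @*^-1 H].
Definition projg2 H : {group gT2} := [group of [morphism of snd] @* H].
Definition ker2 H : {group gT2} := [group of @pair1g gT1 gT2 @*^-1 H].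

Lemma projg1P H a : reflect (exists c, (a, c) \in H) (a \in projg1 H).
Proof.
apply: (iffP morphimP) => [[[a' c] _ Hac ->]|[c Hac]]; first by exists c.
by exists (a, c) => //; rewrite inE.
Qed.

Lemma projg2P H c : reflect (exists a, (a, c) \in H) (c \in projg2 H).
Proof.
apply: (iffP morphimP) => [[[a c'] _ Hac ->]|[a Hac]]; first by exists a.
by exists (a, c) => //; rewrite inE.
Qed.

Lemma ker1E H a : (a \in ker1 H) = ((a, 1) \in H).
Proof. by rewrite !inE. Qed.

Lemma ker2E H c : (c \in ker2 H) = ((1, c) \in H).
Proof. by rewrite !inE. Qed.

Lemma ker1_normal H : ker1 H <| projg1 H.
Proof.
apply/andP; split.
  by apply/subsetP=> a; rewrite ker1E => ?; apply/projg1P; exists 1.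
apply/subsetP=> a /projg1P[c Hac]; rewrite inE.
apply/subsetP=> _ /imsetP[b Bb ->].
rewrite !ker1E in Bb *.
suff <- : (b, 1) ^ (a, c) = (b ^ a, 1) by rewrite groupJ.
by congr pair; rewrite /= mul1g mulVg.
Qed.

Lemma ker2_normal H : ker2 H <| projg2 H.
Proof.
apply/andP; split.
  by apply/subsetP=> a; rewrite ker2E => ?; apply/projg2P; exists 1.
apply/subsetP=> a /projg2P[c Hca]; rewrite inE.
apply/subsetP=> _ /imsetP[b Bb ->].
rewrite !ker2E in Bb *.
suff <- : (1, b) ^ (c, a) = (1, b ^ a) by rewrite groupJ.
by congr pair; rewrite /= mul1g mulVg.
Qed.

Lemma sub_setX_proj H (A : {group gT1}) (C : {group gT2}) :
  (H \subset setX A C) = (projg1 H \subset A) && (projg2 H \subset C).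
Proof.
apply/idP/andP => [/subsetP sH | [/subsetP sA /subsetP sC]].
  by split; apply/subsetP=> x; [move/projg1P|move/projg2P] => -[y /sH];
    rewrite in_setX => /andP[].
apply/subsetP=> -[a c] Hac; rewrite in_setX sA ?sC //.
  by apply/projg2P; exists a.
by apply/projg1P; exists c.
Qed.

(** The first projection restricted to [H] has image [projg1 H], and its kernel is the copy of
    [ker2 H] in the second factor. *)
Lemma card_goursat H : #|H| = (#|projg1 H| * #|ker2 H|)%N.
Proof.
pose f := fst_morphism gT1 gT2.
have nK : H \subset 'N('ker_H f).
  by rewrite normsI ?normG // (subset_trans (subsetT _)) ?ker_norm.
rewrite -(Lagrange (subsetIl H ('ker f))) -card_quotient //.
rewrite (card_isog (first_isog_loc f (subsetT H))) mulnC; congr muln.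
rewrite -(card_injm (injm_pair1g gT1 gT2)) ?subsetT //.
apply: eq_card => -[a c]; rewrite !inE /=.
apply/andP/morphimP => [[Hac /eqP a1]|[d _]].
  by subst a; exists c; rewrite ?ker2E ?in_setT.
by rewrite ker2E => Hd [-> ->]; rewrite eqxx.
Qed.

Definition goursat H := ((projg1 H, ker1 H), (projg2 H, ker2 H)).

(** Send [a] to [g c] for any [c] with [(a, c) \in H]: two such [c] differ by an element of
    [ker2 H], which [g] kills. So [H] is the fibre product of [f] and [g]. Leaving [g] arbitrary
    serves both the count of the subgroups with given data and the isomorphism of the sections. *)
Lemma goursat_morph (rT : finGroupType) H C (g : {morphism C >-> rT}) :
  projg2 H = C -> 'ker g = ker2 H ->
  exists f : {morphism projg1 H >-> rT}, [/\ 'ker f = ker1 H,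
    f @* projg1 H = g @* C &
    {in projg1 H & C, forall a c, ((a, c) \in H) = (f a == g c)}].
Proof.
move=> defC kerg; pose c_ a := odflt 1 [pick c | (a, c) \in H].
have c_P a : a \in projg1 H -> (a, c_ a) \in H.
  by move=> /projg1P[c Hac]; rewrite /c_; case: pickP => [//|/(_ c)]; rewrite Hac.
have inC a c : (a, c) \in H -> c \in C.
  by move=> Hac; rewrite -defC; apply/projg2P; exists a.
have key : {in projg1 H & C, forall a c, ((a, c) \in H) = (g (c_ a) == g c)}.
  move=> a c Aa Cc; have Hc := c_P _ Aa; have Cc' := inC _ _ Hc.
  rewrite -(groupMl _ (groupVr Hc)).
  have -> : (a, c_ a)^-1 * (a, c) = (1, (c_ a)^-1 * c).
    by congr pair; rewrite /= mulVg.
  rewrite -ker2E -[_ \in ker2 H]/(_ \in gval (ker2 H)) -kerg.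
  rewrite !inE groupM ?groupV //=.
  by rewrite morphM ?morphV ?groupV // -eq_invg_mul invgK.
have fM : {in projg1 H &, {morph g \o c_ : a b / a * b}}.
  move=> a b Aa Ab /=; rewrite -morphM; try exact: inC (c_P _ _).
  apply/eqP; rewrite -key ?groupM //; try exact: inC (c_P _ _).
  exact: (groupM (c_P _ Aa) (c_P _ Ab)).
exists (Morphism fM); split=> //.
- apply/setP=> a; rewrite ker1E !inE /=.
  case Aa: (a \in _); first by rewrite key // morph1.
  by apply/esym; apply: contraFF Aa => Ha; apply/projg1P; exists 1.
- apply/setP=> x; apply/morphimP/morphimP => [[a _ Aa ->]|[c _ Cc ->]].
    by exists (c_ a) => //=; apply: inC (c_P _ _).
  have /projg2P[a Hac] : c \in projg2 H by rewrite defC.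
  have Aa : a \in projg1 H by apply/projg1P; exists c.
  by exists a => //=; apply/esym/eqP; rewrite -key.
Qed.

Section Pullback.

Variables (rT : finGroupType) (A : {group gT1}) (C : {group gT2}).
Variables (f : {morphism A >-> rT}) (g : {morphism C >-> rT}).

Definition pullback : {set gT1 * gT2} := [set x in setX A C | f x.1 == g x.2].

Lemma pullbackE a c : ((a, c) \in pullback) = [&& a \in A, c \in C & f a == g c].
Proof. by rewrite !inE /= andbA. Qed.

Fact pullback_group_set : group_set pullback.
Proof.
apply/group_setP; split=> [|[a c] [a' c']].
  by rewrite pullbackE !group1 !morph1 /=.
rewrite !pullbackE => /and3P[Aa Cc /eqP e] /and3P[Aa' Cc' /eqP e'].
by rewrite !groupM ?morphM //= e e'.
Qed.
Canonical pullback_group := Group pullback_group_set.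

(** The equality of the images makes the projections of the fibre product all of [A] and all of
    [C]. *)
Lemma goursat_pullback : f @* A = g @* C ->
  goursat pullback_group = ((A, [group of 'ker f]), (C, [group of 'ker g])).
Proof.
move=> efg; congr ((_, _), (_, _)); apply/val_inj/setP=> x.
- apply/projg1P/idP => [[c]|Ax]; first by rewrite pullbackE => /and3P[].
  have /morphimP[c _ Cc e]: f x \in g @* C by rewrite -efg mem_morphim.
  by exists c; rewrite pullbackE Ax Cc e eqxx.
- by rewrite ker1E pullbackE group1 !inE morph1.
- apply/projg2P/idP => [[c]|Ax]; first by rewrite pullbackE => /and3P[].
  have /morphimP[c _ Cc e]: g x \in f @* A by rewrite efg mem_morphim.
  by exists c; rewrite pullbackE Ax Cc e eqxx.
- by rewrite ker2E pullbackE group1 !inE morph1 eq_sym.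
Qed.

End Pullback.

(** An automorphism [s] of the common image yields the fibre product [gr s] of [s \o f] and [g];
    this is a bijection onto the subgroups with the given data. *)
Lemma card_goursat_ker (rT : finGroupType) A C
    (f : {morphism A >-> rT}) (g : {morphism C >-> rT}) :
  f @* A = g @* C ->
  #|[set H | goursat H == ((A, [group of 'ker f]), (C, [group of 'ker g]))]|
  = #|Aut (f @* A)|.
Proof.
move=> efg.
pose tw (s : {perm rT}) := s \o f.
have twM s : s \in Aut (f @* A) -> {in A &, {morph tw s : a b / a * b}}.
  move=> As a b Aa Ab; rewrite /tw /= morphM //.
  by apply: (morphicP (Aut_morphic As)); rewrite mem_morphim.
pose gr (s : {perm rT}) : {set gT1 * gT2} :=
  [set x in setX A C | s (f x.1) == g x.2].
rewrite -(card_imset _ (@val_inj _ _ {group gT1 * gT2})).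
have injgr : {in Aut (f @* A) &, injective gr}.
  move=> s t As At est; apply: (eq_Aut As At) => _ /morphimP[a _ Aa ->].
  have : s (f a) \in g @* C by rewrite -efg Aut_closed // mem_morphim.
  case/morphimP=> c _ Cc e.
  have : (a, c) \in gr s by rewrite !inE /= Aa Cc e eqxx.
  by rewrite est !inE /= Aa Cc => /eqP->.
rewrite -(card_in_imset injgr); apply: eq_card => X.
apply/imsetP/imsetP => [[H]|[s As ->]]; last first.
  pose h := Morphism (twM s As).
  have kerh : 'ker h = 'ker f.
    apply/setP=> a; rewrite !inE /=; case Aa: (a \in A) => //=.
    apply/eqP/eqP => e; last by rewrite /tw /= e -[RHS](morph1 (autm As)).
    by apply: (@perm_inj _ s); rewrite [LHS]e -[LHS](morph1 (autm As)).
  have imh : h @* A = g @* C.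
    rewrite -efg; apply/eqP; rewrite eqEcard; apply/andP; split.
      apply/subsetP=> _ /morphimP[a _ Aa ->] /=.
      by rewrite Aut_closed // mem_morphim.
    by rewrite !card_morphim !setIid kerh.
  exists (pullback_group h g) => //; rewrite inE goursat_pullback //.
  by apply/eqP; congr ((_, _), _); apply: val_inj.
rewrite inE => /eqP e defX.
case: e => e1 e2 e3 e4; subst X A.
(* Surjectivity: [H] is the fibre product of some [f'] and [g]. As [f'] has the kernel and the image
   of [f], it factors as [h \o f] with [h] an automorphism of the image. *)
have [f' [kerf' imf' keyf']] := goursat_morph e3 (esym e4).
have kff : 'ker f' = 'ker f := etrans kerf' e2.
have skk : 'ker f \subset 'ker f' by rewrite kff.
pose h := factm skk (subxx _).
have injh : 'injm h by rewrite ker_factm kff morphim_ker.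
have imh : h @* (f @* projg1 H) = f @* projg1 H by rewrite morphim_factm efg.
exists (aut injh imh); first exact: Aut_aut.
apply/setP=> -[a c]; rewrite !inE /=.
have [Aa|nAa] := boolP (a \in projg1 H); last first.
  by apply/negbTE; apply: contra nAa => Hac; apply/projg1P; exists c.
have [Cc|nCc] := boolP (c \in C); last first.
  by apply/negbTE; apply: contra nCc => Hac; rewrite -e3; apply/projg2P; exists a.
by rewrite keyf' // autE ?mem_morphim //= /h factmE.
Qed.

Lemma goursat_isog H :
  projg1 H / ker1 H \isog projg2 H / ker2 H.
Proof.
have [_ nD] := andP (ker2_normal H).
pose g := [morphism of restrm nD (coset (ker2 H))].
have kerg : 'ker g = ker2 H.
  by rewrite ker_restrm ker_coset; apply/setIidPr/normal_sub/ker2_normal.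
have [f [<- imf _]] := goursat_morph (erefl _) kerg.
rewrite (isog_trans (first_isog f)) //= imf.
by rewrite morphim_restrm setIid isog_refl.
Qed.

(** An isomorphism [h] from [C / D] to [A / B] turns the two coset maps into morphisms [f] and [g]
    onto the same group [A / B], with kernels [B] and [D]. *)
Lemma card_goursat_fibre A B C D : B <| A -> D <| C ->
  #|[set H | goursat H == ((A, B), (C, D))]| =
  if A / B \isog C / D then #|Aut (A / B)| else 0.
Proof.
move=> nBA nDC; have [[sBA nB] [sDC nD]] := (andP nBA, andP nDC).
case: ifP => [|niso]; last first.
  apply: eq_card0 => H; rewrite inE; apply: contraFF niso => /eqP[<- <- <- <-].
  exact: goursat_isog.
rewrite isog_sym => /isogP[h injh imh].
pose f := [morphism of restrm nB (coset B)].
pose g0 := [morphism of restrm nD (coset D)].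
have imf : f @* A = A / B by rewrite morphim_restrm setIid.
have kerf : 'ker f = B by rewrite ker_restrm ker_coset; apply/setIidPr.
have img0 : g0 @* C = C / D by rewrite morphim_restrm setIid.
have g0C c : c \in C -> g0 c \in C / D by move=> Cc; rewrite -img0 mem_morphim.
have gM : {in C &, {morph h \o g0 : a b / a * b}}.
  by move=> a b Ca Cb /=; rewrite morphM // morphM ?g0C.
pose g := Morphism gM.
have img : g @* C = A / B.
  rewrite -imh; apply/setP=> x; apply/morphimP/morphimP=> -[c _ Cc ->].
    by exists (g0 c); rewrite ?g0C.
  have /morphimP[d Dd Cd ->] : c \in g0 @* C by rewrite img0.
  by exists d.
have kerg : 'ker g = D.
  apply/setP=> c; rewrite !inE /=; case Cc: (c \in C) => /=; last first.
    by apply/esym; apply: contraFF Cc; apply/subsetP.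
  rewrite -(morph1 h) (inj_in_eq (injmP injh)) ?group1 //; last exact: g0C.
  apply/eqP/idP => [|Dc]; last exact: coset_id.
  exact/coset_idr/(subsetP nD).
have := @card_goursat_ker _ A C f g; rewrite imf img => /(_ erefl) <-.
apply: eq_card => H; rewrite !inE; congr (_ == ((_, _), (_, _))); exact: val_inj.
Qed.

End Goursat.

(** * Abelian groups of rank at most two *)

Lemma exponent_quotientP (gT : finGroupType) (G H : {group gT}) n :
  G \subset 'N(H) ->
  reflect (forall x, x \in G -> x ^+ n \in H) (exponent (G / H) %| n).
Proof.
move=> /subsetP nH; apply: (iffP exponentP) => [eGH x Gx|].
  by apply: coset_idr; rewrite ?groupX ?nH // morphX ?nH // eGH ?mem_quotient.
move=> sH _ /morphimP[x Nx Gx ->].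
by rewrite -morphX //; apply/coset_id/sH.
Qed.

(** Exponents are compared below through their multiples, since being a multiple of an exponent is a
    condition on single elements. *)
Lemma eq_dvdn_r m n : (forall k, (m %| k)%N = (n %| k)%N) -> m = n.
Proof. by move=> e; apply/eqP; rewrite eqn_dvd -[in X in _ && X]e e !dvdnn. Qed.

Lemma expg_pair (gT1 gT2 : finGroupType) (x : gT1 * gT2) n :
  x ^+ n = (x.1 ^+ n, x.2 ^+ n).
Proof. by elim: n => // n IHn; rewrite expgS IHn !expgS. Qed.

Lemma abelian_setX (gT1 gT2 : finGroupType)
    (G1 : {group gT1}) (G2 : {group gT2}) :
  abelian G1 -> abelian G2 -> abelian (setX G1 G2).
Proof.
move=> ab1 ab2; apply/centsP=> -[a c] /setXP[Ga Gc] [b d] /setXP[Gb Gd].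
by congr pair; [apply: (centsP ab1) | apply: (centsP ab2)].
Qed.

Section ProductExponent.

Variables gT1 gT2 : finGroupType.
Implicit Type H : {group gT1 * gT2}.

Lemma exponent_goursat H :
  exponent H = lcmn (exponent (projg1 H)) (exponent (projg2 H)).
Proof.
apply: eq_dvdn_r => n; rewrite dvdn_lcm; apply/exponentP/andP => [eH|].
  split; apply/exponentP => x.
    by case/projg1P=> y /eH; rewrite expg_pair => -[].
  by case/projg2P=> y /eH; rewrite expg_pair => -[].
case=> /exponentP e1 /exponentP e2 [a c] Hac.
rewrite expg_pair /= e1 ?e2 //; first by apply/projg2P; exists a.
by apply/projg1P; exists c.
Qed.

(** All [(a ^+ n, c ^+ n)] lie in [H] exactly when all [(a ^+ n, 1)] and all [(1, c ^+ n)] do: take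
    [c = 1] or [a = 1] one way, multiply the other way. *)
Lemma exponent_quotient_goursat (G1 : {group gT1}) (G2 : {group gT2}) H :
    abelian G1 -> abelian G2 -> H \subset setX G1 G2 ->
  exponent (setX G1 G2 / H) =
    lcmn (exponent (G1 / ker1 H)) (exponent (G2 / ker2 H)).
Proof.
move=> ab1 ab2 sH; have := sH; rewrite sub_setX_proj => /andP[sH1 sH2].
have n1 : G1 \subset 'N(ker1 H).
  by rewrite sub_abelian_norm // (subset_trans _ sH1) ?normal_sub ?ker1_normal.
have n2 : G2 \subset 'N(ker2 H).
  by rewrite sub_abelian_norm // (subset_trans _ sH2) ?normal_sub ?ker2_normal.
have nH : setX G1 G2 \subset 'N(H) by rewrite sub_abelian_norm ?abelian_setX.
apply: eq_dvdn_r => n; rewrite dvdn_lcm.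
apply/(exponent_quotientP n nH)/andP => [eH|]; last first.
  case=> /(exponent_quotientP n n1) e1 /(exponent_quotientP n n2) e2.
  case=> a c /setXP[Ga Gc]; rewrite expg_pair /=.
  have /e1 := Ga; rewrite ker1E => H1; have /e2 := Gc; rewrite ker2E => H2.
  suff -> : (a ^+ n, c ^+ n) = (a ^+ n, 1) * (1, c ^+ n) by rewrite groupM.
  by congr pair; rewrite /= ?mulg1 ?mul1g.
split; [apply/(exponent_quotientP n n1)|apply/(exponent_quotientP n n2)];
  move=> x Gx.
  rewrite ker1E; have := eH (x, 1); rewrite expg_pair expg1n; apply.
  by rewrite in_setX Gx group1.
rewrite ker2E; have := eH (1, x); rewrite expg_pair expg1n; apply.
by rewrite in_setX Gx group1.
Qed.

End ProductExponent.

(** Of the at most two invariant factors the larger is the exponent, and their product is the order.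
    The filter removes trivial factors. *)
Lemma abelian_type_rank2 (gT : finGroupType) (G : {group gT}) :
  abelian G -> 'r(G) <= 2 ->
  abelian_type G = [seq m <- [:: exponent G; #|G| %/ exponent G] | 1 < m]%N.
Proof.
move=> abG; rewrite -size_abelian_type //.
have := abelian_type_dvdn_sorted G; have := abelian_type_gt1 G.
have [b defG <-] := abelian_structure abG; rewrite size_map.
case: b defG => [|x [|y [|z b]]] //=.
- by rewrite big_nil => <-; rewrite exponent1 cards1.
- rewrite big_seq1 => <-; rewrite andbT exponent_cycle -orderE => x1.
  by rewrite divnn order_gt0 x1.
rewrite !big_cons big_nil dprodg1 => defG /and3P[x1 y1 _] /andP[dyx _] _.
rewrite -(dprod_exponent defG) -(dprod_card defG) !exponent_cycle -!orderE.
by rewrite (lcmn_idPl _) // mulKn ?order_gt0 // x1 y1.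
Qed.

Lemma isog_rank2 (gT rT : finGroupType) (G : {group gT}) (H : {group rT}) :
    abelian G -> abelian H -> 'r(G) <= 2 -> 'r(H) <= 2 ->
  (G \isog H) = (#|G| == #|H|) && (exponent G == exponent H).
Proof.
move=> abG abH rG rH; apply/idP/andP => [iso|[/eqP eo /eqP ee]].
  by rewrite (card_isog iso) (exponent_isog iso) !eqxx.
by rewrite eq_abelian_type_isog // !abelian_type_rank2 // eo ee.
Qed.

Lemma card_Aut_isog (gT rT : finGroupType) (G : {group gT}) (H : {group rT}) :
  G \isog H -> #|Aut G| = #|Aut H|.
Proof. by case/isogP=> f injf <-; rewrite -(card_isog (injm_Aut injf _)). Qed.

Lemma card_goursat_cyclic (gT1 gT2 : finGroupType)
    (A B : {group gT1}) (C D : {group gT2}) :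
    B \subset A -> D \subset C -> cyclic A -> cyclic C ->
  #|[set H | goursat H == ((A, B), (C, D))]| =
  if #|A : B| == #|C : D| then totient #|A : B| else 0.
Proof.
move=> sBA sDC cA cC.
have nBA : B <| A by rewrite -sub_abelian_normal ?cyclic_abelian.
have nDC : D <| C by rewrite -sub_abelian_normal ?cyclic_abelian.
rewrite card_goursat_fibre //= isog_cyclic_card ?quotient_cyclic //= eq_sym.
by rewrite card_Aut_cyclic ?quotient_cyclic // !card_quotient ?normal_norm.
Qed.

Local Open Scope nat_scope.

(** * Subgroups of a product of two cyclic p-groups *)

(* The quintuple of a subgroup [H] of [G1 * G2] with projections [A], [C] and  *)
(* kernels [B], [D] has [#|B| = p ^ x1], [#|G1 : A| = p ^ x2],                 *)
(* [#|A : B| = #|C : D| = p ^ x3], [#|D| = p ^ x4] and [#|G2 : C| = p ^ x5].   *)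
(* Then [H] has type [(p ^ qmin x, p ^ qmax x)] and [G1 * G2 / H] has type     *)
(* [(p ^ qcomin x, p ^ qcomax x)].                                             *)
Definition qfst (x : quint) : nat :=
  let: (x1, x2, x3, x4, x5) := x in x1 + x2 + x3.
Definition qsnd (x : quint) : nat :=
  let: (x1, x2, x3, x4, x5) := x in x3 + x4 + x5.
Definition qmid (x : quint) : nat :=
  let: (x1, x2, x3, x4, x5) := x in x3.
Definition qorder (x : quint) : nat :=
  let: (x1, x2, x3, x4, x5) := x in x1 + x3 + x4.
Definition qmin (x : quint) : nat :=
  let: (x1, x2, x3, x4, x5) := x in minn x1 x4.
Definition qmax (x : quint) : nat :=
  let: (x1, x2, x3, x4, x5) := x in x3 + maxn x1 x4.
Definition qcomin (x : quint) : nat :=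
  let: (x1, x2, x3, x4, x5) := x in minn x2 x5.
Definition qcomax (x : quint) : nat :=
  let: (x1, x2, x3, x4, x5) := x in x3 + maxn x2 x5.
Definition qrel (a b : nat) (x : quint) : bool := (qfst x == a) && (qsnd x == b).

(** The box of all quintuples with entries below [M]. As [qrel a b] bounds every entry by [a] or
    [b], a box with [M] above both contains all relevant quintuples. *)
Definition quints (M : nat) : seq quint :=
  let pairs S (s : seq S) := [seq (q, i) | q <- s, i <- iota 0 M] in
  pairs _ (pairs _ (pairs _ (pairs _ (iota 0 M)))).

Lemma uniq_quints M : uniq (quints M).
Proof.
by do !apply: allpairs_uniq; rewrite ?iota_uniq // => -[? ?] [? ?] _ _ [-> ->].
Qed.

Lemma mem_quints M a b x : a < M -> b < M -> qrel a b x -> x \in quints M.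
Proof.
case: x => [[[[x1 x2] x3] x4] x5] aM bM /andP[/eqP /= ea /eqP eb].
by do !apply: allpairs_f; rewrite mem_iota /= add0n; lia.
Qed.

Lemma big_seq_unique (T : eqType) (s : seq T) (P : pred T) x0 (E : T -> nat) :
    uniq s -> x0 \in s -> P x0 -> (forall x, P x -> x = x0) ->
  \sum_(x <- s | P x) E x = E x0.
Proof.
move=> us sx0 Px0 uP.
rewrite big_mkcond (bigD1_seq x0) //= Px0 big1 ?addn0 // => x.
by case: ifP => // /uP->; rewrite eqxx.
Qed.

Section CyclicSquare.

Variables (p a b : nat) (gT1 gT2 : finGroupType).
Variables (G1 : {group gT1}) (G2 : {group gT2}).
Hypotheses (p_pr : prime p) (cG1 : cyclic G1) (cG2 : cyclic G2).
Hypotheses (oG1 : #|G1| = p ^ a) (oG2 : #|G2| = p ^ b).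

Implicit Type H : {group gT1 * gT2}.

Definition quint_of H : quint :=
  (logn p #|ker1 H|, logn p #|G1 : projg1 H|, logn p #|projg1 H : ker1 H|,
   logn p #|ker2 H|, logn p #|G2 : projg2 H|).

(** The same data in terms of orders only. Together with [qrel a b] they determine [x], see
    [has_quint_inj]. *)
Definition has_quint H (x : quint) :=
  let: (x1, x2, x3, x4, x5) := x in
  [/\ #|ker1 H| = p ^ x1, #|projg1 H| = p ^ (x1 + x3),
      #|ker2 H| = p ^ x4 & #|projg2 H| = p ^ (x3 + x4)].

Let sub_index n (gT : finGroupType) (A B : {group gT}) : B \subset A ->
  #|A| = p ^ n ->
  [/\ #|B| = p ^ logn p #|B|, #|A : B| = p ^ logn p #|A : B|
    & logn p #|B| + logn p #|A : B| = n].
Proof.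
move=> sBA oA; have p1 := prime_gt1 p_pr.
have /(dvdn_pfactor _ _ p_pr)[i _ oB]: #|B| %| p ^ n by rewrite -oA cardSg.
have /(dvdn_pfactor _ _ p_pr)[j _ iB]: #|A : B| %| p ^ n.
  by rewrite -oA dvdn_indexg.
rewrite oB iB !pfactorK //; split=> //; apply/eqP.
by rewrite -(eqn_exp2l _ _ p1) expnD -oB -iB Lagrange ?oA.
Qed.

Lemma quint_ofP H : H \subset setX G1 G2 ->
  qrel a b (quint_of H) /\ has_quint H (quint_of H).
Proof.
rewrite sub_setX_proj => /andP[sA sC].
have sB := normal_sub (ker1_normal H); have sD := normal_sub (ker2_normal H).
have [oA iA e1] := sub_index sA oG1; have [oB iB e2] := sub_index sB oA.
have [oC iC e3] := sub_index sC oG2; have [oD iD e4] := sub_index sD oC.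
(* The single entry [x3] serves both factors because the two sections are isomorphic. *)
have eAC : #|projg1 H : ker1 H| = #|projg2 H : ker2 H|.
  rewrite -!card_quotient ?normal_norm ?ker1_normal ?ker2_normal //.
  exact/card_isog/goursat_isog.
rewrite eAC in e2; rewrite /qrel /quint_of /= eAC.
split; first by rewrite addnAC e2 e1 (addnC (logn p #|_ : _|)) e4 e3 !eqxx.
by split=> //; rewrite ?e2 // addnC e4.
Qed.

Lemma has_quint_inj H x : H \subset setX G1 G2 ->
  qrel a b x -> has_quint H x -> quint_of H = x.
Proof.
move=> sH; have [] := quint_ofP sH.
case: (quint_of H) x => [[[[x1 x2] x3] x4] x5] [[[[y1 y2] y3] y4] y5].
rewrite /qrel /= => /andP[/eqP e1 /eqP e2] [-> -> -> ->] /andP[/eqP e3 /eqP e4].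
have inj m n : p ^ m = p ^ n -> m = n.
  by move/eqP; rewrite eqn_exp2l ?prime_gt1 // => /eqP.
case=> /inj ? /inj ? /inj ? /inj ?; congr (_, _, _, _, _); lia.
Qed.

Lemma has_quint_order H x : has_quint H x -> #|H| = p ^ qorder x.
Proof.
case: x => [[[[x1 x2] x3] x4] x5] [_ oA oD _].
by rewrite card_goursat oA oD -expnD.
Qed.

Lemma has_quint_exponent H x : H \subset setX G1 G2 -> has_quint H x ->
  exponent H = p ^ qmax x.
Proof.
rewrite sub_setX_proj => /andP[sA sC].
case: x => [[[[x1 x2] x3] x4] x5] [_ oA _ oC].
rewrite exponent_goursat !exponent_cyclic ?(cyclicS sA) ?(cyclicS sC) // oA oC.
by rewrite -expn_max /=; congr (_ ^ _); lia.
Qed.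

Lemma has_quint_coexponent H x : H \subset setX G1 G2 -> qrel a b x ->
  has_quint H x -> exponent (setX G1 G2 / H) = p ^ qcomax x.
Proof.
move=> sH; move: (sH); rewrite sub_setX_proj => /andP[sA sC].
have [ab1 ab2] := (cyclic_abelian cG1, cyclic_abelian cG2).
have sB := subset_trans (normal_sub (ker1_normal H)) sA.
have sD := subset_trans (normal_sub (ker2_normal H)) sC.
case: x => [[[[x1 x2] x3] x4] x5] /andP[/eqP /= ea /eqP eb] [oB _ oD _].
rewrite exponent_quotient_goursat // !exponent_cyclic ?quotient_cyclic //.
rewrite !card_quotient ?sub_abelian_norm // -!divgS // oG1 oG2 oB oD.
rewrite -!expnB ?prime_gt0 //; try lia.
by rewrite -expn_max /=; congr (_ ^ _); lia.
Qed.

Let subgroup_of_order n m (gT : finGroupType) (G : {group gT}) :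
  cyclic G -> #|G| = p ^ n -> m <= n ->
  exists2 A : {group gT}, A \subset G & #|A| = p ^ m.
Proof.
move=> /cyclicP[x ->] oG lemn.
have : p ^ m %| #[x] by rewrite orderE oG dvdn_exp2l.
move/cycle_sub_group/setP/(_ <[x ^+ (#[x] %/ p ^ m)]>%G).
by rewrite !inE eqxx => /andP[sA /eqP oA]; exists <[x ^+ (#[x] %/ p ^ m)]>%G.
Qed.

(** A cyclic group has exactly one subgroup of each order dividing its own, so [x] determines the
    four groups of the Goursat data, and only the isomorphism between two cyclic sections of order
    [p ^ x3] remains free. *)
Lemma card_quint_of x : qrel a b x ->
  #|[set H in subgroups (setX G1 G2) | quint_of H == x]| = totient (p ^ qmid x).
Proof.
move=> ab; move: (ab); have p1 := prime_gt1 p_pr.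
case: x ab => [[[[x1 x2] x3] x4] x5] xab /andP[/eqP /= ea /eqP eb].
have [A sA oA] : exists2 A : {group gT1}, A \subset G1 & #|A| = p ^ (x1 + x3).
  by apply: subgroup_of_order cG1 oG1 _; lia.
have [B sB oB] : exists2 A : {group gT1}, A \subset G1 & #|A| = p ^ x1.
  by apply: subgroup_of_order cG1 oG1 _; lia.
have [C sC oC] : exists2 A : {group gT2}, A \subset G2 & #|A| = p ^ (x3 + x4).
  by apply: subgroup_of_order cG2 oG2 _; lia.
have [D sD oD] : exists2 A : {group gT2}, A \subset G2 & #|A| = p ^ x4.
  by apply: subgroup_of_order cG2 oG2 _; lia.
have sBA : B \subset A.
  by rewrite -(cardSg_cyclic cG1) // oA oB dvdn_exp2l ?leq_addr.
have sDC : D \subset C.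
  by rewrite -(cardSg_cyclic cG2) // oC oD dvdn_exp2l ?leq_addl.
have i1 : #|A : B| = p ^ x3.
  by rewrite -divgS // oA oB -expnB ?prime_gt0 ?leq_addr ?addKn.
have i2 : #|C : D| = p ^ x3.
  by rewrite -divgS // oC oD -expnB ?prime_gt0 ?leq_addl ?addnK.
have := card_goursat_cyclic sBA sDC (cyclicS sA cG1) (cyclicS sC cG2).
rewrite i1 i2 eqxx => <-; apply: eq_card => H; rewrite !inE.
apply/andP/eqP => [[sH /eqP e]|[e1 e2 e3 e4]].
  have [_] := quint_ofP sH; rewrite e => -[oB' oA' oD' oC'].
  move: sH; rewrite sub_setX_proj => /andP[sA' sC'].
  have sB' := subset_trans (normal_sub (ker1_normal H)) sA'.
  have sD' := subset_trans (normal_sub (ker2_normal H)) sC'.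
  congr ((_, _), (_, _)); apply/val_inj/eqP.
  - by rewrite (eq_subG_cyclic cG1) // oA' oA.
  - by rewrite (eq_subG_cyclic cG1) // oB' oB.
  - by rewrite (eq_subG_cyclic cG2) // oC' oC.
  - by rewrite (eq_subG_cyclic cG2) // oD' oD.
have sH : H \subset setX G1 G2 by rewrite sub_setX_proj e1 e3 sA.
split=> //; apply/eqP/has_quint_inj => //.
by split; rewrite ?e1 ?e2 ?e3 ?e4.
Qed.

(** The hypothesis on [F] hands over the order, exponent and coexponent of [H], which by rank at
    most two fix the types of [H] and of its quotient. *)
Lemma sum_subgroups_cyclic M (F : {group gT1 * gT2} -> nat) (E : quint -> nat) :
    a < M -> b < M ->
    (forall H x, H \subset setX G1 G2 -> qrel a b x ->
       #|H| = p ^ qorder x -> exponent H = p ^ qmax x ->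
       exponent (setX G1 G2 / H) = p ^ qcomax x -> F H = E x) ->
  \sum_(H in subgroups (setX G1 G2)) F H =
  \sum_(x <- quints M | qrel a b x) totient (p ^ qmid x) * E x.
Proof.
move=> aM bM FE.
(* Each [F H] becomes a sum over [x] with one nonzero range, so that exchanging the sums counts the
   subgroups with quintuple [x]. *)
transitivity (\sum_(H in subgroups (setX G1 G2))
                \sum_(x <- quints M | qrel a b x && (quint_of H == x)) E x).
  apply: eq_bigr => H; rewrite inE => sH.
  have [xab hx] := quint_ofP sH.
  rewrite (big_seq_unique (x0 := quint_of H)) ?uniq_quints ?xab ?eqxx //.
  - apply: FE => //; [exact: has_quint_order | exact: has_quint_exponent |].
    exact: has_quint_coexponent.
  - exact: mem_quints xab.
  - by move=> x /andP[_ /eqP].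
rewrite (exchange_big_dep (qrel a b)) /=; last by move=> H x _ /andP[].
apply: eq_bigr => x xab; rewrite -(card_quint_of xab).
rewrite sum_nat_cond_const; congr muln.
by apply: eq_card => H; rewrite !inE xab.
Qed.

End CyclicSquare.

(** * Abelian p-groups of rank at most two and their chains of subgroups *)

Lemma rank_setX_cyclic (gT1 gT2 : finGroupType)
    (G1 : {group gT1}) (G2 : {group gT2}) :
  cyclic G1 -> cyclic G2 -> 'r(setX G1 G2) <= 2.
Proof.
move=> cG1 cG2; have [p _ ->] := rank_witness (setX G1 G2).
have := morphim_cyclic (pairg1_morphism gT1 gT2) cG1.
rewrite morphim_pairg1 => c1.
have := morphim_cyclic (pair1g_morphism gT1 gT2) cG2.
rewrite morphim_pair1g => c2.
rewrite -(p_rank_dprod p (setX_dprod G1 G2)) -[2]/(1 + 1) leq_add //.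
  apply: leq_trans (p_rank_le_rank _ _) _.
  by rewrite -abelian_rank1_cyclic ?cyclic_abelian.
apply: leq_trans (p_rank_le_rank _ _) _.
by rewrite -abelian_rank1_cyclic ?cyclic_abelian.
Qed.

Lemma sum_subgroups_injm (aT rT : finGroupType) (K : {group aT})
    (f : {morphism K >-> rT}) (F : {group rT} -> nat) : 'injm f ->
  \sum_(B in subgroups (f @* K)) F B = \sum_(B in subgroups K) F (f @* B)%G.
Proof.
move=> injf.
rewrite -(big_imset (h := fun B : {group aT} => (f @* B)%G)); last first.
  move=> B C; rewrite !inE => sB sC /(congr1 val) /= e.
  by apply/val_inj/(injm_morphim_inj injf).
apply: eq_bigl => B; apply/idP/imsetP => [|[C]]; rewrite inE => sB; last first.
  by move->; rewrite inE morphimS.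
exists (f @*^-1 B)%G; first by rewrite inE subsetIl.
by apply: val_inj; rewrite /= morphpreK.
Qed.

Lemma exponent_quotient_injm (aT rT : finGroupType) (K B : {group aT})
    (f : {morphism K >-> rT}) :
    'injm f -> abelian K -> B \subset K ->
  exponent (f @* K / f @* B) = exponent (K / B).
Proof.
move=> injf abK sBK; have nB : K \subset 'N(B) by rewrite sub_abelian_norm.
have nfB : f @* K \subset 'N(f @* B).
  by rewrite sub_abelian_norm ?morphim_abelian ?morphimS.
apply: eq_dvdn_r => n.
apply/(exponent_quotientP n nfB)/(exponent_quotientP n nB) => [e x Kx|e y].
  have := e _ (mem_morphim f Kx Kx); rewrite -morphX // => /morphimP[y Ky By].
  by move=> efx; rewrite (injmP injf _ _ _ _ efx) ?groupX.
by case/morphimP=> x _ Kx ->; rewrite -morphX // mem_morphim ?e // groupX.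
Qed.

Lemma cyclic_Zp n : cyclic (Zp_group n).
Proof.
by rewrite /= /Zp; case: ifP => _; rewrite ?cyclic1 // Zp_cycle cycle_cyclic.
Qed.

Section ZpSquare.

Variables (p : nat) (p_pr : prime p).

Let p_gt0 n : 0 < p ^ n. Proof. by rewrite expn_gt0 prime_gt0. Qed.

Lemma card_Zp2 i j : #|Zp2 (p ^ i) (p ^ j)| = p ^ (i + j).
Proof. by rewrite cardsX !card_Zp // expnD. Qed.

Lemma abelian_Zp2 m n : abelian (Zp2 m n).
Proof. by rewrite abelian_setX ?cyclic_abelian ?cyclic_Zp. Qed.

Lemma rank_Zp2 m n : 'r(Zp2 m n) <= 2.
Proof. by rewrite rank_setX_cyclic ?cyclic_Zp. Qed.

Lemma exponent_Zp2 i j : exponent (Zp2 (p ^ i) (p ^ j)) = p ^ maxn i j.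
Proof.
rewrite exponent_goursat /= morphim_fstX morphim_sndX.
by rewrite !exponent_cyclic ?cyclic_Zp // !card_Zp // expn_max.
Qed.

Lemma isog_Zp2 (gT : finGroupType) (A : {group gT}) i j :
    abelian A -> 'r(A) <= 2 ->
    #|A| = p ^ (i + j) -> exponent A = p ^ maxn i j ->
  Zp2 (p ^ i) (p ^ j) \isog A.
Proof.
move=> abA rA oA eA.
by rewrite isog_rank2 ?abelian_Zp2 ?rank_Zp2 // card_Zp2 exponent_Zp2 oA eA !eqxx.
Qed.

(** Order and exponent identify [A] with a product of two cyclic groups, and the sum is transported
    along the isomorphism. *)
Lemma sum_subgroups_rank2 (gT : finGroupType) (A : {group gT}) i j M
    (F : {group gT} -> nat) (E : quint -> nat) :
    abelian A -> 'r(A) <= 2 ->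
    #|A| = p ^ (i + j) -> exponent A = p ^ maxn i j ->
    i < M -> j < M ->
    (forall (B : {group gT}) y, B \subset A -> qrel i j y ->
       #|B| = p ^ qorder y -> exponent (A / B) = p ^ qcomax y -> F B = E y) ->
  \sum_(B in subgroups A) F B =
  \sum_(y <- quints M | qrel i j y) totient (p ^ qmid y) * E y.
Proof.
move=> abA rA oA eA iM jM FE.
have /isogP[f injf imf] := isog_Zp2 abA rA oA eA.
rewrite -imf sum_subgroups_injm //.
apply: (sum_subgroups_cyclic p_pr (cyclic_Zp _) (cyclic_Zp _)) => //;
  try by rewrite card_Zp.
move=> B y sB rely oB _ eB; apply: FE => //; first by rewrite -imf morphimS.
  by rewrite card_injm.
by rewrite -imf exponent_quotient_injm ?abelian_Zp2.
Qed.

Lemma sum_chains (gT1 gT2 : finGroupType) (G1 : {group gT1}) (G2 : {group gT2})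
    a b M (F : {group gT1 * gT2} -> {group gT1 * gT2} -> nat)
    (E : quint -> quint -> nat) :
    cyclic G1 -> cyclic G2 -> #|G1| = p ^ a -> #|G2| = p ^ b -> a + b < M ->
    (forall (A B : {group gT1 * gT2}) x y,
       A \subset setX G1 G2 -> B \subset A ->
       qrel a b x -> qrel (qmin x) (qmax x) y ->
       #|A| = p ^ qorder x -> #|B| = p ^ qorder y ->
       exponent (A / B) = p ^ qcomax y -> F A B = E x y) ->
  \sum_(A in subgroups (setX G1 G2)) \sum_(B in subgroups A) F A B =
  \sum_(x <- quints M | qrel a b x)
    \sum_(y <- quints M | qrel (qmin x) (qmax x) y)
      totient (p ^ qmid x) * totient (p ^ qmid y) * E x y.
Proof.
move=> cG1 cG2 oG1 oG2 abM FE.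
under [RHS]eq_bigr do under eq_bigr do rewrite -mulnA.
under [RHS]eq_bigr do rewrite -big_distrr /=.
apply: (sum_subgroups_cyclic p_pr cG1 cG2 oG1 oG2); try lia.
move=> A x sA relx oA eA _.
have ab : abelian (setX G1 G2) by rewrite abelian_setX ?cyclic_abelian.
(* These put the order and exponent of [A] in the form [p ^ (i + j)] and [p ^ maxn i j] with
   [i = qmin x], [j = qmax x]. Both are at most [a + b], hence below [M]. *)
have [e1 [e2 [e3 e4]]] : qmin x + qmax x = qorder x /\ qmax x < M /\
    qmin x < M /\ maxn (qmin x) (qmax x) = qmax x.
  by case: x relx {oA eA} => [[[[x1 x2] x3] x4] x5] /andP[/eqP /= ? /eqP ?]; lia.
apply: sum_subgroups_rank2; rewrite ?e1 ?e4 ?(abelianS sA) //.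
  by rewrite (leq_trans (rankS sA)) ?rank_setX_cyclic.
by move=> B y sB rely oB eB; apply: FE.
Qed.

End ZpSquare.

(** * Goursat sums and the types of the quotients *)

(** The subgroups are partitioned by their Goursat data. The order is constant on each class, so a
    class is counted entirely or not at all. *)
Lemma card_subgroups_setX (gT1 gT2 : finGroupType)
    (G : {group gT1}) (K : {group gT2}) (q : nat) :
    abelian G -> abelian K ->
  #|[set H in subgroups (setX G K) | #|H| == q]| =
  \sum_(A in subgroups G) \sum_(B in subgroups A)
  \sum_(C in subgroups K) \sum_(D in subgroups C)
    if (#|A| * #|D| == q) && (A / B \isog C / D) then #|Aut (A / B)| else 0.
Proof.
move=> abG abK.
under [RHS]eq_bigr do under eq_bigr do rewrite pair_big_dep /=.
rewrite pair_big_dep pair_big /= -sum1_card.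
rewrite (partition_big (@goursat gT1 gT2) (fun j =>
  (j.1.1 \in subgroups G) && (j.1.2 \in subgroups j.1.1) &&
  ((j.2.1 \in subgroups K) && (j.2.2 \in subgroups j.2.1)))) /=; last first.
  move=> H; rewrite !inE sub_setX_proj => /andP[/andP[-> ->] _].
  by rewrite !normal_sub ?ker1_normal ?ker2_normal.
apply: eq_bigr => -[[A B] [C D]] /=; rewrite !inE.
move=> /andP[/andP[sA sB] /andP[sC sD]].
have nBA : B <| A by rewrite -sub_abelian_normal ?(abelianS sA).
have nDC : D <| C by rewrite -sub_abelian_normal ?(abelianS sC).
rewrite sum1_card; case: eqP => [oq | nq] /=.
  rewrite -card_goursat_fibre //; apply: eq_card => H.
  rewrite !inE unfold_in !inE.
  rewrite andb_idl // => /eqP[e1 e2 e3 e4].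
  by rewrite sub_setX_proj card_goursat e1 e3 e4 sA sC oq eqxx.
apply: eq_card0 => H; rewrite unfold_in !inE.
apply/negP=> /andP[/andP[_ /eqP oH]].
by case/eqP=> e1 _ _ e4; case: nq; rewrite -oH card_goursat e1 e4.
Qed.

Lemma qorder_split x : qmin x + qmax x = qorder x.
Proof. by case: x => [[[[x1 x2] x3] x4] x5] /=; lia. Qed.

(** This is Lagrange's theorem, read in the exponents of [p]. *)
Lemma qorder_coorder i j y :
  qrel i j y -> qorder y + (qcomin y + qcomax y) = i + j.
Proof. by case: y => [[[[x1 x2] x3] x4] x5] /andP[/eqP /= <- /eqP <-]; lia. Qed.

Lemma qcomin_le y : qcomin y <= qcomax y.
Proof. by case: y => [[[[x1 x2] x3] x4] x5] /=; lia. Qed.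

Section QuotientType.

Variables (p : nat) (p_pr : prime p).

Lemma card_quotient_quint (gT : finGroupType) (A B : {group gT}) x y :
    abelian A -> B \subset A -> qrel (qmin x) (qmax x) y ->
    #|A| = p ^ qorder x -> #|B| = p ^ qorder y ->
  #|A / B| = p ^ (qcomin y + qcomax y).
Proof.
move=> abA sBA rely oA oB.
rewrite card_quotient ?sub_abelian_norm // -divgS // oA oB.
by rewrite -qorder_split -(qorder_coorder rely) -expnB ?prime_gt0 ?leq_addr ?addKn.
Qed.

(** The quotients have rank at most two, so only orders and exponents matter. Once the exponents
    agree, equality of the orders reduces to that of [qcomin]. *)
Lemma isog_quotient_quint (gT rT : finGroupType)
    (A B : {group gT}) (C D : {group rT}) x y z t :
    abelian A -> abelian C -> 'r(A) <= 2 -> 'r(C) <= 2 ->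
    B \subset A -> D \subset C ->
    qrel (qmin x) (qmax x) y -> qrel (qmin z) (qmax z) t ->
    #|A| = p ^ qorder x -> #|B| = p ^ qorder y ->
    #|C| = p ^ qorder z -> #|D| = p ^ qorder t ->
    exponent (A / B) = p ^ qcomax y -> exponent (C / D) = p ^ qcomax t ->
  (A / B \isog C / D) = (qcomin y == qcomin t) && (qcomax y == qcomax t).
Proof.
move=> abA abC rA rC sBA sDC rely relt oA oB oC oD eAB eCD.
rewrite isog_rank2 ?quotient_abelian // ?(leq_trans (quotient_rank_abelian _ _)) //.
rewrite eAB eCD (card_quotient_quint abA sBA rely) //.
rewrite (card_quotient_quint abC sDC relt) //.
rewrite !eqn_exp2l ?prime_gt1 //.
by case: (qcomax y =P qcomax t) => [->|_]; rewrite ?eqn_add2r // !andbF.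
Qed.

Lemma card_Aut_quotient_quint (gT : finGroupType) (A B : {group gT}) x y :
    abelian A -> 'r(A) <= 2 -> B \subset A -> qrel (qmin x) (qmax x) y ->
    #|A| = p ^ qorder x -> #|B| = p ^ qorder y ->
    exponent (A / B) = p ^ qcomax y ->
  #|Aut (A / B)| = num_aut (p ^ qcomin y) (p ^ qcomax y).
Proof.
move=> abA rA sBA rely oA oB eAB; apply/esym/card_Aut_isog/isog_Zp2 => //.
- exact: quotient_abelian.
- exact: leq_trans (quotient_rank_abelian _ _) _.
- exact: card_quotient_quint oA oB.
by rewrite (maxn_idPr (qcomin_le y)).
Qed.

End QuotientType.

(** * The index set as nested sums over quintuples, and the conclusion *)

Definition index_test (a b c d k : nat)
    (w : quint * quint * quint * quint) : bool :=
  let: (x, y, z, t) := w in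
  [&& qrel a b x, qrel (qmin x) (qmax x) y,
      qrel c d z, qrel (qmin z) (qmax z) t,
      qcomin y == qcomin t, qcomax y == qcomax t & qorder x + qorder t == k].

Lemma index_setP a b c d k w : index_set a b c d k w <-> index_test a b c d k w.
Proof.
move: w => [[[[[[[x1 x2] x3] x4] x5] [[[[y1 y2] y3] y4] y5]]
  [[[[z1 z2] z3] z4] z5]] [[[[t1 t2] t3] t4] t5]].
by rewrite /index_set /index_test /qrel /= -!andbA !addnA.
Qed.

Lemma summandE p x y z t : summand p (x, y, z, t) =
  totient (p ^ qmid x) * totient (p ^ qmid y) *
  (totient (p ^ qmid z) * totient (p ^ qmid t) *
   num_aut (p ^ qcomin y) (p ^ qcomax y)).
Proof.
move: x y z t => [[[[? ?] ?] ?] ?] [[[[? ?] ?] ?] ?].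
by move=> [[[[? ?] ?] ?] ?] [[[[? ?] ?] ?] ?]; rewrite /= !mulnA.
Qed.

(** The index set lies in the box: [qrel a b x] bounds [x], and [y] is bounded through
    [qmin x + qmax x = qorder x <= a + b]; likewise for [z] and [t]. *)
Lemma fsbig_index_set a b c d k M (f : quint * quint * quint * quint -> nat) :
    a + b < M -> c + d < M ->
  \big[addn/0]_(w \in index_set a b c d k) f w =
  \sum_(x <- quints M) \sum_(y <- quints M)
  \sum_(z <- quints M) \sum_(t <- quints M)
     if index_test a b c d k (x, y, z, t) then f (x, y, z, t) else 0.
Proof.
move=> abM cdM; pose Q := quints M.
pose S := [seq (xyz, t) |
  xyz <- [seq (xy, z) | xy <- [seq (x, y) | x <- Q, y <- Q], z <- Q], t <- Q].
have memS w : index_test a b c d k w -> w \in S.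
  case: w => [[[x y] z] t] /and5P[xab yx zcd tz _].
  have [eab ecd] := (qorder_coorder xab, qorder_coorder zcd).
  have [ex ez] := (qorder_split x, qorder_split z).
  do !apply: allpairs_f.
  - by apply: mem_quints xab; lia.
  - by apply: mem_quints yx; lia.
  - by apply: mem_quints zcd; lia.
  - by apply: mem_quints tz; lia.
rewrite (fsbigE [seq w <- S | index_test a b c d k w]).
- rewrite big_seq_cond.
  rewrite (eq_bigl (mem [seq w <- S | index_test a b c d k w])); last first.
    move=> w; rewrite andb_idr // mem_filter => /andP[iw _].
    exact/mem_set/index_setP.
  by rewrite -big_seq big_filter big_mkcond !big_allpairs.
- rewrite filter_uniq //.
  by do !apply: allpairs_uniq; rewrite ?iota_uniq // => -[? ?] [? ?] _ _ [-> ->].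
- by move=> w /=; rewrite mem_filter => /andP[/index_setP].
by move=> w /index_setP iw; rewrite mem_filter iw memS.
Qed.

Theorem corollary2 (p : nat) (hp : prime p) (a b c d k : nat)
    (hk : k <= a + b + c + d) :
  num_subgroups (p ^ a) (p ^ b) (p ^ c) (p ^ d) (p ^ k) =
  \big[addn/0]_(w \in index_set a b c d k) summand p w.
Proof.
pose M := (a + b + c + d).+1.
rewrite (@fsbig_index_set _ _ _ _ _ M); [| rewrite /M; lia | rewrite /M; lia].
have p_gt0 n : 0 < p ^ n by rewrite expn_gt0 prime_gt0.
rewrite /num_subgroups card_subgroups_setX ?abelian_Zp2 //.
(* [E3] is the contribution of a pair of chains with these quintuples; [E] is its weighted sum over
   the chains in the second factor. *)
pose E3 x y t :=
  if [&& qcomin y == qcomin t, qcomax y == qcomax t & qorder x + qorder t == k]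
  then num_aut (p ^ qcomin y) (p ^ qcomax y) else 0.
pose E x y := \sum_(z <- quints M | qrel c d z)
  \sum_(t <- quints M | qrel (qmin z) (qmax z) t)
    totient (p ^ qmid z) * totient (p ^ qmid t) * E3 x y t.
(* This expands the chains [B <= A]. That the inner sum depends on them only through [x] and [y] is
   shown by applying [sum_chains] again, to the chains [D <= C]. *)
rewrite (@sum_chains p hp _ _ _ _ a b M _ E) ?cyclic_Zp ?card_Zp //; first last.
- move=> A B x y sA sB relx rely oA oB eAB.
  have abA := abelianS sA (abelian_Zp2 _ _).
  have rA := leq_trans (rankS sA) (rank_Zp2 _ _).
  apply: sum_chains; rewrite ?cyclic_Zp ?card_Zp //; first by rewrite /M; lia.
  move=> C D z t sC sD relz relt oC oD eCD.
  have abC := abelianS sC (abelian_Zp2 _ _).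
  have rC := leq_trans (rankS sC) (rank_Zp2 _ _).
  rewrite (isog_quotient_quint hp abA abC rA rC sB sD rely relt) //.
  rewrite (card_Aut_quotient_quint hp abA rA sB rely) //.
  by rewrite oA oD -expnD eqn_exp2l ?prime_gt1 // /E3 andbC andbA.
- by rewrite /M; lia.
(* The two nested sums are matched one quintuple at a time; where a [qrel] condition fails,
   [index_test] is false and all inner terms vanish. *)
rewrite big_mkcond; apply: eq_bigr => x _; case: ifP => xab; last first.
  by apply/esym; do 3!apply: big1 => ? _; rewrite /= xab.
rewrite big_mkcond; apply: eq_bigr => y _; case: ifP => yx; last first.
  by apply/esym; do 2!apply: big1 => ? _; rewrite /= xab yx.
rewrite /E big_distrr big_mkcond.
apply: eq_bigr => z _; case: ifP => zcd; last first.
  by apply/esym; apply: big1 => ? _; rewrite /= xab yx zcd.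
rewrite big_distrr big_mkcond.
apply: eq_bigr => t _; rewrite summandE /= xab yx zcd /=.
case: ifP => //= tz; rewrite /E3; case: ifP => _; rewrite ?muln0 //.
Qed.
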